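(* Let $\alpha:I\to\mathbb{E}^4_1$ be a null Cartan curve with constant curvatures $\kappa_2=p$, $\kappa_3=q$, and let $\lambda_0\in\mathbb{R}\setminus\{0\}$. Then $\alpha$ is a Type I normal helix with $\langle V,W\rangle=c_0=0$, that is, there is a fixed vector $W\in\mathbb{E}^4_1\setminus\{0\}$ with $\langle V,W\rangle=0$ for all $s\in I$, where $V=\lambda_0T+N$, if and only if $$\kappa_3^2=\lambda_0^2\bigl(\lambda_0^2+\kappa_2^2\bigr).$$ This has two branches: $\kappa_3=\pm\lambda_0\sqrt{\lambda_0^2+\kappa_2^2}$.
   Context: Minkowski space-time $\mathbb{E}^4_1$ is $\mathbb{R}^4$ with the metric $\langle x,y\rangle=-x_1y_1+x_2y_2+x_3y_3+x_4y_4$. A null Cartan curve is a smooth null curve $\alpha:I\to\mathbb{E}^4_1$ ($I$ an interval, $\alpha'\neq0$, $\langle\alpha',\alpha'\rangle=0$) parametrized by pseudo-arc length $s$ (so $\langle\alpha'',\alpha''\rangle=1$), together with its Cartan frame $\{T,N,B_1,B_2\}$, $T=\alpha'$, $N=\alpha''$, where $\langle T,T\rangle=\langle B_2,B_2\rangle=0$, $\langle N,N\rangle=\langle B_1,B_1\rangle=1$, $\langle T,B_2\rangle=1$, all other inner products of frame vectors vanish, $\det(T,N,B_1,B_2)=1$, and $$T'=N,\quad N'=\kappa_2B_1-B_2,\quad B_1'=\kappa_3T-\kappa_2N,\quad B_2'=-\kappa_3B_1$$ for smooth functions $\kappa_2,\kappa_3:I\to\mathbb{R}$ (the Cartan curvatures).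 Primes denote $d/ds$. A null Cartan curve is a normal helix with field $V$ (a combination of $T,N,B_1$ with constant coefficients) and fixed axis $W$ (a vector independent of $s$) if $\langle V,W\rangle=c_0$ for a constant $c_0\in\mathbb{R}$; it is of Type I if $V=\lambda_0T+N$ with $\lambda_0$ constant.
   Formalization: The hypothesis κ₃ = q ≠ 0 is added: if q = 0, the nonzero vector W = B₁ + pT is fixed and orthogonal to λ₀T + N for every λ₀, while q² = λ₀²(λ₀² + p²) fails for every λ₀ ≠ 0, so the stated equivalence is false there. *)

(* Defs.v *)
(* MathComp-Analysis; the real line is an arbitrary [R : realType]. *)
From HB Require Import structures.
From mathcomp Require Import all_boot all_order all_algebra.
From mathcomp Require Import all_classical all_reals all_analysis.

Set Implicit Arguments.
Unset Strict Implicit.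
Unset Printing Implicit Defensive.

Import Order.TTheory GRing.Theory Num.Theory.
Import numFieldNormedType.Exports.

Local Open Scope ring_scope.
Local Open Scope classical_set_scope.

(* The Minkowski scalar product; the time coordinate x_1 has index 0. *)
Definition minkowski_dot (R : realType) (x y : 'rV[R]_4) : R :=
  - (x 0 0 * y 0 0) + x 0 1 * y 0 1 + x 0 2 * y 0 2 + x 0 3 * y 0 3.

Definition det4 (R : realType) (v1 v2 v3 v4 : 'rV[R]_4) : R :=
  \det (\matrix_(i < 4) [:: v1; v2; v3; v4]`_i).

(* Smoothness on a set which need not be open: [f], a total function, is
   C^oo on some open neighbourhood of [I].  An interval which contains an end
   point is thus covered; there [f] is a smooth extension past the end point,
   and since [I] has more than one point the derivatives of [f] at the points
   of [I] depend on the values of [f] on [I] only. *)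
Definition smooth_on (R : realType) (V : normedModType R) (I : set R)
    (f : R -> V) : Prop :=
  exists U : set R, [/\ open U, I `<=` U &
    forall (n : nat) (s : R), U s -> derivable (f^`(n)) s 1].

Definition cartanT (R : realType) (alpha : R -> 'rV[R]_4) : R -> 'rV[R]_4 :=
  alpha^`().

Definition cartanN (R : realType) (alpha : R -> 'rV[R]_4) : R -> 'rV[R]_4 :=
  alpha^`(2).

(* [alpha] is parametrized by pseudo-arc length and its Cartan frame is
   (alpha', alpha'', B1, B2); the equation T' = N holds by definition, and the
   nullity and pseudo-arc length conditions are [ncc_TT] and [ncc_NN]. *)
Record null_cartan_curve (R : realType) (I : set R) (alpha : R -> 'rV[R]_4)
    (B1 B2 : R -> 'rV[R]_4) (kappa2 kappa3 : R -> R) : Prop := {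
  ncc_interval : is_interval I;
  ncc_nondegenerate : exists a b : R, [/\ a < b, I a & I b];
  ncc_smooth : smooth_on I alpha;
  ncc_smooth_B1 : smooth_on I B1;
  ncc_smooth_B2 : smooth_on I B2;
  ncc_smooth_kappa2 : smooth_on I (kappa2 : R -> R^o);
  ncc_smooth_kappa3 : smooth_on I (kappa3 : R -> R^o);
  ncc_regular : forall s, I s -> cartanT alpha s != 0;
  ncc_TT : forall s, I s -> minkowski_dot (cartanT alpha s) (cartanT alpha s) = 0;
  ncc_NN : forall s, I s -> minkowski_dot (cartanN alpha s) (cartanN alpha s) = 1;
  ncc_B1B1 : forall s, I s -> minkowski_dot (B1 s) (B1 s) = 1;
  ncc_B2B2 : forall s, I s -> minkowski_dot (B2 s) (B2 s) = 0;
  ncc_TN : forall s, I s -> minkowski_dot (cartanT alpha s) (cartanN alpha s) = 0;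
  ncc_TB1 : forall s, I s -> minkowski_dot (cartanT alpha s) (B1 s) = 0;
  ncc_TB2 : forall s, I s -> minkowski_dot (cartanT alpha s) (B2 s) = 1;
  ncc_NB1 : forall s, I s -> minkowski_dot (cartanN alpha s) (B1 s) = 0;
  ncc_NB2 : forall s, I s -> minkowski_dot (cartanN alpha s) (B2 s) = 0;
  ncc_B1B2 : forall s, I s -> minkowski_dot (B1 s) (B2 s) = 0;
  ncc_det : forall s, I s ->
    det4 (cartanT alpha s) (cartanN alpha s) (B1 s) (B2 s) = 1;
  ncc_N' : forall s, I s ->
    (cartanN alpha)^`() s = kappa2 s *: B1 s - B2 s;
  ncc_B1' : forall s, I s ->
    B1^`() s = kappa3 s *: cartanT alpha s - kappa2 s *: cartanN alpha s;
  ncc_B2' : forall s, I s -> B2^`() s = - (kappa3 s *: B1 s)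
}.

(* The field a T + b N + c B1. *)
Definition normal_field (R : realType) (alpha B1 : R -> 'rV[R]_4)
    (a b c : R) (s : R) : 'rV[R]_4 :=
  a *: cartanT alpha s + b *: cartanN alpha s + c *: B1 s.

Definition normal_helix (R : realType) (I : set R) (V : R -> 'rV[R]_4)
    (W : 'rV[R]_4) (c0 : R) : Prop :=
  forall s, I s -> minkowski_dot (V s) W = c0.

(* Type I: V = lambda0 T + N. *)
Definition typeI_normal_helix (R : realType) (I : set R)
    (alpha B1 : R -> 'rV[R]_4) (lambda0 : R) (W : 'rV[R]_4) (c0 : R) : Prop :=
  normal_helix I (normal_field alpha B1 lambda0 1 0) W c0.

(* Main.v *)
Require Import Defs.
From mathcomp Require Import all_boot all_order all_algebra.
From mathcomp Require Import all_classical all_reals all_analysis.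
From mathcomp Require Import ring.

(** With constant curvatures, d/ds acts on the fields with constant
    coefficients in the frame (T, N, B1, B2) as a constant 4 x 4 matrix A
    ([frame_field_derive]), whose characteristic polynomial is
    X^4 + p^2 X^2 - q^2.  This polynomial is even, and the condition
    q^2 = lambda0^2 (lambda0^2 + p^2) says that lambda0, or equivalently
    - lambda0, is one of its roots.  Both implications come from that.

    If W is orthogonal to V = lambda0 T + N along the curve, it is orthogonal
    to all the derivatives of V, and those of order at most 3 have coefficients
    V, A V, A^2 V, A^3 V ([helix_characteristic]).  Equivalently,
    t = <T, W> satisfies t' = - lambda0 t, so that - lambda0 is an eigenvalue
    unless t = 0; but t = 0 forces the other three products with the frame to
    vanish as well when q <> 0, and then W = 0 because the frame is a basis and
    the metric is nondegenerate.

    Conversely, let F be a frame field whose coefficients form an eigenvector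
    of A for lambda0.  Then F' = lambda0 F, so F is a positive scalar function
    times a fixed vector ([exponential_growth]), although its coefficients in
    the moving frame are constant.  The eigenvector is orthogonal to V, hence
    any value of F is a fixed axis ([characteristic_helix]).

    The two branches are the two square roots of q^2. *)

Set Implicit Arguments.
Unset Strict Implicit.
Unset Printing Implicit Defensive.

Import Order.TTheory GRing.Theory Num.Theory.
Import numFieldNormedType.Exports.
Local Open Scope ring_scope.
Local Open Scope classical_set_scope.

(** * The Minkowski product *)

Lemma minkowski_dotDl (R : realType) (x y z : 'rV[R]_4) :
  minkowski_dot (x + y) z = minkowski_dot x z + minkowski_dot y z.
Proof. by rewrite /minkowski_dot !mxE; ring. Qed.

Lemma minkowski_dotZl (R : realType) (k : R) (x z : 'rV[R]_4) :
  minkowski_dot (k *: x) z = k * minkowski_dot x z.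
Proof. by rewrite /minkowski_dot !mxE; ring. Qed.

Lemma minkowski_dotC (R : realType) (x y : 'rV[R]_4) :
  minkowski_dot x y = minkowski_dot y x.
Proof. by rewrite /minkowski_dot; ring. Qed.

Lemma minkowski_dot0r (R : realType) (x : 'rV[R]_4) : minkowski_dot x 0 = 0.
Proof. by rewrite /minkowski_dot !mxE; ring. Qed.

(** The four products are the entries of M c, where M has rows v1, ..., v4 and
    c is W with its time coordinate negated. *)
Lemma minkowski_nondegenerate (R : realType) (v1 v2 v3 v4 W : 'rV[R]_4) :
  det4 v1 v2 v3 v4 != 0 ->
  minkowski_dot v1 W = 0 -> minkowski_dot v2 W = 0 ->
  minkowski_dot v3 W = 0 -> minkowski_dot v4 W = 0 -> W = 0.
Proof.
rewrite /det4; set M := matrix_of_fun _ _ => detM h1 h2 h3 h4.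
pose c : 'cV[R]_4 := \col_j (if j == 0 then - W 0 j else W 0 j).
have Mc : M *m c = 0.
  apply/matrixP => i j; rewrite !mxE !big_ord_recl big_ord0 !mxE /=.
  move: h1 h2 h3 h4; rewrite /minkowski_dot.
  have -> : lift ord0 ord0 = 1 :> 'I_4 by apply/val_inj.
  have -> : lift ord0 (lift ord0 ord0) = 2 :> 'I_4 by apply/val_inj.
  have -> : lift ord0 (lift ord0 (lift ord0 ord0)) = 3 :> 'I_4.
    by apply/val_inj.
  have -> : ord0 = 0 :> 'I_4 by apply/val_inj.
  move=> h1 h2 h3 h4.
  case: i => -[|[|[|[|//]]]] ilt /=.
  - by rewrite -[RHS]h1; ring.
  - by rewrite -[RHS]h2; ring.
  - by rewrite -[RHS]h3; ring.
  - by rewrite -[RHS]h4; ring.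
have unitM : M \in unitmx by rewrite unitmxE unitfE.
have c0 : c = 0 by rewrite -(mulKmx unitM c) Mc mulmx0.
apply/rowP => j; rewrite mxE; move/colP: c0 => /(_ j); rewrite !mxE.
by case: ifP => // _ /eqP; rewrite oppr_eq0 => /eqP.
Qed.

(** * Derivatives along an interval *)

Lemma is_derive_coord (R : realType) n (f : R -> 'rV[R]_n) (df : 'rV[R]_n)
    (s : R) (i : 'I_n) :
  is_derive s 1 f df -> is_derive s 1 (fun t => f t 0 i : R^o) (df 0 i).
Proof.
move=> fdf; have df_ : derivable f s 1 by [].
apply: DeriveDef; first exact: (derivable_mxP _ _ _).1.
by rewrite -(@derive_val _ _ _ _ _ _ _ fdf) derive_mx // mxE.
Qed.

Lemma is_derive_minkowski (R : realType) (f : R -> 'rV[R]_4)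
    (df W : 'rV[R]_4) (s : R) :
  is_derive s 1 f df ->
  is_derive s 1 (fun t => minkowski_dot (f t) W : R^o) (minkowski_dot df W).
Proof.
move=> fdf.
have d i : is_derive s (1 : R) (fun t => f t 0 i * W 0 i : R^o)
    (df 0 i * W 0 i).
  apply: (is_derive_eq (is_deriveM (is_derive_coord i fdf)
    (is_derive_cst (W 0 i : R^o) s (1 : R)))).
  by rewrite scaler0 add0r /GRing.scale /= mulrC.
exact: (is_deriveD (is_deriveD (is_deriveD (is_deriveN (d 0)) (d 1)) (d 2))
  (d 3)).
Qed.

Lemma is_interval_itvoo (R : realType) (I : set R) (x y s : R) :
  is_interval I -> I x -> I y -> x < s < y -> I s.
Proof.
move=> Iitv Ix Iy /andP[/ltW xs /ltW sy].
by apply: (Iitv x y) => //; rewrite xs.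
Qed.

Lemma vanishing_is_derive (R : realType) (f : R -> R) (a b s df : R) :
  (forall t, a < t < b -> f t = 0) -> a < s < b ->
  is_derive s 1 (f : R -> R^o) df -> df = 0.
Proof.
move=> f0 sab fdf.
have c0 : is_derive s 1 (cst 0 : R -> R^o) df.
  apply: near_eq_is_derive fdf.
  have : s \in `]a, b[%R by rewrite in_itv.
  by move=> /near_in_itvoo; apply: filterS => t; rewrite in_itv /= => /f0 ->.
by rewrite -(@derive_val _ _ _ _ _ _ _ c0) derive_cst.
Qed.

(** The function exp (- l x) f x has derivative 0, hence is constant by the
    mean value theorem. *)
Lemma exponential_growth (R : realType) (I : set R) (f : R -> R) (l : R) :
  is_interval I ->
  (forall s, I s -> is_derive s 1 (f : R -> R^o) (l * f s)) ->
  forall s t, I s -> I t -> f t = expR (l * (t - s)) * f s.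
Proof.
move=> Iitv fl.
pose g x := expR (- (l * x)) * f x.
have dg x : I x -> is_derive x 1 (g : R -> R^o) 0.
  move=> Ix.
  have dl : is_derive x 1 (fun y => - (l * y) : R^o) (- l).
    have -> : (fun y => - (l * y) : R^o) = - (l \*: (id : R -> R^o)) by [].
    by apply: is_derive_eq; rewrite /GRing.scale /= mulr1.
  have := is_deriveM (is_derive1_comp (is_derive_expR _) dl) (fl x Ix).
  by move=> /is_derive_eq; apply; rewrite /GRing.scale /=; ring.
have gle x y : I x -> I y -> x <= y -> g x = g y.
  move=> Ix Iy xy.
  have Iz z : x <= z <= y -> I z by exact: Iitv Ix Iy z.
  have [] := @MVT_segment R g (cst 0) x y xy.
  - move=> z; rewrite in_itv /= => /andP[xz zy]; apply: dg; apply: Iz.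
    by rewrite !ltW.
  - apply: derivable_within_continuous => z; rewrite in_itv /= => zxy.
    by have := dg z (Iz z zxy).
  - by move=> c _ /eqP; rewrite mul0r subr_eq0 => /eqP.
move=> s t Is It; have : g s = g t.
  by case: (leP s t) => [|/ltW] st; [|apply/esym]; exact: gle.
rewrite /g => gst.
by rewrite mulrBr expRD -mulrA gst mulrA -expRD subrr expR0 mul1r.
Qed.

(** * Fields with constant coefficients in the Cartan frame *)

Section frame_field.
Variables (R : realType) (I : set R) (alpha B1 B2 : R -> 'rV[R]_4).
Variables (kappa2 kappa3 : R -> R).
Hypothesis Halpha : null_cartan_curve I alpha B1 B2 kappa2 kappa3.

Definition frame_field (a b c d : R) (s : R) : 'rV[R]_4 :=
  a *: cartanT alpha s + b *: cartanN alpha s + c *: B1 s + d *: B2 s.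

Lemma normal_fieldE (a b c s : R) :
  normal_field alpha B1 a b c s = frame_field a b c 0 s.
Proof. by rewrite /normal_field /frame_field (scale0r (B2 s)) addr0. Qed.

Lemma minkowski_frame_field (a b c d a' b' c' d' s : R) : I s ->
  minkowski_dot (frame_field a b c d s) (frame_field a' b' c' d' s) =
  a * d' + d * a' + b * b' + c * c'.
Proof.
move=> Is; rewrite /frame_field !(minkowski_dotDl, minkowski_dotZl).
rewrite ![minkowski_dot _ (_ + _ + _ + _)]minkowski_dotC.
rewrite !(minkowski_dotDl, minkowski_dotZl).
rewrite (minkowski_dotC (cartanN alpha s) (cartanT alpha s)).
rewrite !(minkowski_dotC (B1 s) (cartanT alpha s)).
rewrite !(minkowski_dotC (B2 s) (cartanT alpha s)).
rewrite !(minkowski_dotC (B1 s) (cartanN alpha s)).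
rewrite !(minkowski_dotC (B2 s) (cartanN alpha s)).
rewrite (minkowski_dotC (B2 s) (B1 s)).
rewrite (ncc_TT Halpha Is) (ncc_NN Halpha Is) (ncc_B1B1 Halpha Is).
rewrite (ncc_B2B2 Halpha Is) (ncc_TN Halpha Is) (ncc_TB1 Halpha Is).
rewrite (ncc_TB2 Halpha Is) (ncc_NB1 Halpha Is) (ncc_NB2 Halpha Is).
by rewrite (ncc_B1B2 Halpha Is); ring.
Qed.

Lemma smooth_is_derive (f : R -> 'rV[R]_4) n s : smooth_on I f -> I s ->
  is_derive s 1 (f^`(n)) (f^`(n.+1) s).
Proof.
move=> [U [_ IU dU]] Is; rewrite derive1nS derive1E.
exact/derivableP/dU/IU.
Qed.

(** The Cartan equations in matrix form: for constant curvatures the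
    coefficients of the derivative are those of A (a, b, c, d). *)
Lemma frame_field_derive (a b c d s : R) : I s ->
  is_derive s 1 (frame_field a b c d)
    (frame_field (c * kappa3 s) (a - c * kappa2 s)
                 (b * kappa2 s - d * kappa3 s) (- b) s).
Proof.
move=> Is.
have dT : is_derive s 1 (cartanT alpha) (cartanN alpha s).
  exact: (smooth_is_derive 1%N (ncc_smooth Halpha) Is).
have dN : is_derive s 1 (cartanN alpha) (kappa2 s *: B1 s - B2 s).
  rewrite -(ncc_N' Halpha Is).
  exact: (smooth_is_derive 2%N (ncc_smooth Halpha) Is).
have dB1 : is_derive s 1 B1
    (kappa3 s *: cartanT alpha s - kappa2 s *: cartanN alpha s).
  rewrite -(ncc_B1' Halpha Is).
  exact: (smooth_is_derive 0%N (ncc_smooth_B1 Halpha) Is).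
have dB2 : is_derive s 1 B2 (- (kappa3 s *: B1 s)).
  rewrite -(ncc_B2' Halpha Is).
  exact: (smooth_is_derive 0%N (ncc_smooth_B2 Halpha) Is).
have -> : frame_field a b c d = a \*: cartanT alpha + b \*: cartanN alpha
    + c \*: B1 + d \*: B2 by [].
apply: is_derive_eq.
by apply/rowP => i; rewrite !mxE; ring.
Qed.

End frame_field.

(** * Helices and the characteristic equation *)

Section helix.
Variables (R : realType) (I : set R) (alpha B1 B2 : R -> 'rV[R]_4).
Variables (kappa2 kappa3 : R -> R) (p q lambda0 : R).
Hypothesis Halpha : null_cartan_curve I alpha B1 B2 kappa2 kappa3.
Hypothesis Hkappa2 : forall s, I s -> kappa2 s = p.
Hypothesis Hkappa3 : forall s, I s -> kappa3 s = q.

(** The open interval ]x, y[ replaces I, which may contain an end point: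
    an identity valid on I only cannot be differentiated there, as the
    derivative is two-sided. *)
Lemma frame_field_orthogonal_derive (W : 'rV[R]_4) (a b c d x y : R) :
  I x -> I y ->
  (forall s, x < s < y ->
    minkowski_dot (frame_field alpha B1 B2 a b c d s) W = 0) ->
  forall s, x < s < y ->
    minkowski_dot (frame_field alpha B1 B2
      (c * q) (a - c * p) (b * p - d * q) (- b) s) W = 0.
Proof.
move=> Ix Iy ortho s sxy.
have Is := is_interval_itvoo (ncc_interval Halpha) Ix Iy sxy.
rewrite -(Hkappa2 Is) -(Hkappa3 Is).
apply: (vanishing_is_derive ortho sxy).
exact/is_derive_minkowski/(frame_field_derive Halpha).
Qed.

(** Orthogonality of W to V and its first three derivatives is a linear system
    in the products of W with the frame.  Eliminating the last three unknowns
    leaves (q^2 - lambda0^2 (lambda0^2 + p^2)) <T, W> = 0. *)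
Lemma helix_characteristic (W : 'rV[R]_4) : q != 0 -> W != 0 ->
  typeI_normal_helix I alpha B1 lambda0 W 0 ->
  q ^+ 2 = lambda0 ^+ 2 * (lambda0 ^+ 2 + p ^+ 2).
Proof.
move=> q0 W0 helixW.
have [x [y [xy Ix Iy]]] := ncc_nondegenerate Halpha.
have Ixy := is_interval_itvoo (ncc_interval Halpha) Ix Iy.
have h0 s : x < s < y ->
    minkowski_dot (frame_field alpha B1 B2 lambda0 1 0 0 s) W = 0.
  by move=> /Ixy Is; rewrite -normal_fieldE; exact: helixW.
have h1 := frame_field_orthogonal_derive Ix Iy h0.
have h2 := frame_field_orthogonal_derive Ix Iy h1.
have h3 := frame_field_orthogonal_derive Ix Iy h2.
have [s m] : exists s, x < s < y.
  by exists ((x + y) / 2); rewrite !(midf_lt xy).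
have Is := Ixy s m.
move: (h0 s m) (h1 s m) (h2 s m) (h3 s m) => {h0 h1 h2 h3}.
rewrite /frame_field !(minkowski_dotDl, minkowski_dotZl).
set t := minkowski_dot (cartanT _ _) W.
set n := minkowski_dot (cartanN _ _) W.
set b1 := minkowski_dot (B1 _) W.
set b2 := minkowski_dot (B2 _) W => h0 h1 h2 h3.
have e0 : lambda0 * t + n = 0 by rewrite -[RHS]h0; ring.
have e1 : lambda0 * n + p * b1 - b2 = 0 by rewrite -[RHS]h1; ring.
have e2 : p * q * t - p ^+ 2 * n + (lambda0 * p + q) * b1 - lambda0 * b2 = 0.
  by rewrite -[RHS]h2; ring.
have e3 : q * (lambda0 * p + q) * t - lambda0 * p ^+ 2 * n
    + (lambda0 * q - p ^+ 3) * b1 + p ^+ 2 * b2 = 0.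
  by rewrite -[RHS]h3; ring.
have t_neq0 : t != 0.
  apply: contra W0 => /eqP t0.
  have n0 : n = 0 by rewrite -[RHS]e0 t0; ring.
  have b10 : b1 = 0.
    apply: (mulfI q0); rewrite mulr0.
    transitivity (p * q * t - p ^+ 2 * n + (lambda0 * p + q) * b1
      - lambda0 * b2 - lambda0 * (lambda0 * n + p * b1 - b2)).
      by rewrite t0 n0; ring.
    by rewrite e1 e2; ring.
  have b20 : b2 = 0.
    by apply: oppr_inj; rewrite oppr0 -[RHS]e1 n0 b10; ring.
  apply/eqP; apply: (minkowski_nondegenerate _ t0 n0 b10 b20).
  by rewrite (ncc_det Halpha Is) oner_eq0.
apply: (mulIf t_neq0); apply/eqP; rewrite -subr_eq0 -[X in _ == X]e3.
apply/eqP.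
(* Up to the vanishing left-hand sides of e0, e1, e2, this is
   e3 - lambda0 e2 + (lambda0^2 + p^2) e1
   - lambda0 (lambda0^2 + p^2) e0; the coefficients 1, - lambda0,
   lambda0^2 + p^2, ... are those of the quotient of the characteristic
   polynomial by X + lambda0. *)
transitivity (q * (lambda0 * p + q) * t - lambda0 * p ^+ 2 * n
    + (lambda0 * q - p ^+ 3) * b1 + p ^+ 2 * b2
    - lambda0 * (p * q * t - p ^+ 2 * n + (lambda0 * p + q) * b1
                 - lambda0 * b2)
    + (lambda0 ^+ 2 + p ^+ 2) * (lambda0 * n + p * b1 - b2)
    - lambda0 * (lambda0 ^+ 2 + p ^+ 2) * (lambda0 * t + n)).
  by ring.
by rewrite e0 e1 e2; ring.
Qed.

(** The axis is the value at a point of I of the frame field with coefficients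
    (p c - lambda0^3, - lambda0^2, c, lambda0), where c = - (p lambda0 + q).
    These are an eigenvector of A for lambda0, obtained by setting the B2
    coefficient to lambda0 and reading the others off the equations; the T row
    is the remaining one and amounts to the characteristic equation. *)
Lemma characteristic_helix : lambda0 != 0 ->
  q ^+ 2 = lambda0 ^+ 2 * (lambda0 ^+ 2 + p ^+ 2) ->
  exists W, W != 0 /\ typeI_normal_helix I alpha B1 lambda0 W 0.
Proof.
move=> l0 E.
pose c := - (p * lambda0 + q).
pose a := p * c - lambda0 ^+ 3.
pose F := frame_field alpha B1 B2 a (- lambda0 ^+ 2) c lambda0.
have dF s : I s -> is_derive s 1 F (lambda0 *: F s).
  move=> Is.
  have := frame_field_derive Halpha a (- lambda0 ^+ 2) c lambda0 Is.
  rewrite (Hkappa2 Is) (Hkappa3 Is) => /is_derive_eq; apply.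
  rewrite /F /frame_field !scalerDr !scalerA.
  congr (_ *: _ + _ *: _ + _ *: _ + _ *: _); rewrite /a /c; [|ring..].
  by ring: E.
have [s0 [_ [_ Is0 _]]] := ncc_nondegenerate Halpha.
exists (F s0); split.
  (* The product with T is the B2 coefficient. *)
  apply/eqP => F0.
  have := minkowski_frame_field Halpha 1 0 0 0 a (- lambda0 ^+ 2) c lambda0 Is0.
  rewrite -/(F s0) F0 minkowski_dot0r => /esym/eqP.
  by rewrite !mul0r !addr0 mul1r (negbTE l0).
move=> s Is; have -> : F s0 = expR (lambda0 * (s0 - s)) *: F s.
  apply/rowP => i; rewrite [RHS]mxE.
  have dFi t : I t ->
      is_derive t 1 (fun u => F u 0 i : R^o) (lambda0 * F t 0 i).
    by move=> It; have := is_derive_coord i (dF t It);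
      rewrite [X in is_derive _ _ _ X]mxE.
  exact: (exponential_growth (ncc_interval Halpha) dFi Is Is0).
rewrite minkowski_dotC minkowski_dotZl minkowski_dotC (normal_fieldE _ _ B2).
by rewrite (minkowski_frame_field Halpha) //; ring.
Qed.

End helix.

Unset Implicit Arguments.

(* The hypothesis [q != 0] is needed: for q = 0 the vector B1 + p T is nonzero,
   independent of s and orthogonal to lambda0 T + N for every lambda0. *)
Theorem theorem4 (R : realType) (I : set R) (alpha B1 B2 : R -> 'rV[R]_4)
    (kappa2 kappa3 : R -> R) (p q lambda0 : R)
    (Halpha : null_cartan_curve I alpha B1 B2 kappa2 kappa3)
    (Hkappa2 : forall s, I s -> kappa2 s = p)
    (Hkappa3 : forall s, I s -> kappa3 s = q)
    (Hq : q != 0)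
    (Hlambda0 : lambda0 != 0) :
  ((exists W : 'rV[R]_4,
      W != 0 /\ typeI_normal_helix I alpha B1 lambda0 W 0)
   <-> q ^+ 2 = lambda0 ^+ 2 * (lambda0 ^+ 2 + p ^+ 2))
  /\ (q ^+ 2 = lambda0 ^+ 2 * (lambda0 ^+ 2 + p ^+ 2)
      <-> (q = lambda0 * Num.sqrt (lambda0 ^+ 2 + p ^+ 2)
           \/ q = - (lambda0 * Num.sqrt (lambda0 ^+ 2 + p ^+ 2)))).
Proof.
split.
  split; last exact: (characteristic_helix Halpha Hkappa2 Hkappa3 Hlambda0).
  move=> [W [W0 helixW]].
  exact: (helix_characteristic Halpha Hkappa2 Hkappa3 Hq W0 helixW).
have ge0 : 0 <= lambda0 ^+ 2 + p ^+ 2 by rewrite addr_ge0 ?sqr_ge0.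
rewrite -{1}(sqr_sqrtr ge0) -exprMn; split.
  by move=> /eqP; rewrite eqf_sqr => /orP[] /eqP; [left|right].
by case=> ->; rewrite ?sqrrN.
Qed.
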